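(* Let $G$ be a connected finite simple graph with $p$ vertices and $q$ edges, and let $\mathcal{P}_G$ be its graphicahedron (defined in the context). Then $\mathcal{P}_G$ is a simple abstract polytope of rank $q$ with $p!$ vertices and $p!\,q!$ flags. Moreover, the symmetric group $S_p$, acting on $\mathcal{P}_G$ by $(K,\alpha)\mapsto (K,\alpha\gamma)$ for $\gamma\in S_p$ (and fixing the least face), acts by polytope automorphisms and simply transitively on the vertices of $\mathcal{P}_G$.
   Context: Let $G$ have vertex set $\{1,\dots,p\}$ and edge set $E(G)$ with $|E(G)|=q$. For an edge $e=\{i,j\}$ let $\tau_e=(i\;j)\in S_p$ be the corresponding transposition. For $K\subseteq E(G)$ let $T_K=\langle \tau_e : e\in K\rangle\le S_p$ (the trivial group if $K=\emptyset$). The graphicahedron $\mathcal{P}_G$ is the poset defined as follows: consider all pairs $(K,\alpha)$ with $K\subseteq E(G)$ and $\alpha\in S_p$, identified by $(K,\alpha)\sim(L,\beta)$ iff $K=L$ and $T_K\alpha=T_L\beta$ (equality of right cosets); order the classes by $(K,\alpha)\le (L,\beta)$ iff $K\subseteq L$ and $T_K\alpha\subseteq T_L\beta$; the rank of $(K,\alpha)$ is $|K|$; finally adjoin a least element of rank $-1$. Faces of rank $0$ are vertices. An abstract polytope of rank $n$ is a poset with a strictly monotone rank function onto $\{-1,0,\dots,n\}$, having a least and a greatest element, in which every maximal chain (flag) has $n+2$ elements, which is strongly flag-connected (any two flags $\Phi,\Psi$ are joined by a sequence of flags, each containing $\Phi\cap\Psi$, consecutive ones differing in exactly one element), and which satisfies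 the diamond condition (whenever $F< H$ with ranks $j-1$ and $j+1$, there are exactly two faces of rank $j$ strictly between them). An abstract polytope of rank $q$ is simple if each vertex-figure (the section of faces $\ge$ a given vertex) is isomorphic to the face lattice of the $(q-1)$-simplex. *)

(* Defs.v *)
From HB Require Import structures.
From mathcomp Require Import all_boot all_order all_algebra all_fingroup.
(* Imported last so that [repr] is the quotient representative, not that of
   fingroup. *)
From mathcomp Require Import generic_quotient.
Set Implicit Arguments.
Unset Strict Implicit.
Unset Printing Implicit Defensive.
Import Order.TTheory GRing.Theory Num.Theory.

Local Open Scope ring_scope.

Definition order_iso d d' (T : porderType d) (T' : porderType d')
    (f : T -> T') : Prop :=
  bijective f /\ {mono f : x y / (x <= y)%O}.

Section AbstractPolytopes.

Context {d : Order.disp_t} {T : finPOrderType d}.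
Implicit Types (x y v : T) (F : {set T}).

Definition is_chain F : bool := [forall x in F, forall y in F, (x >=< y)%O].

Definition is_flag F : bool := maxset is_chain F.

Definition flags_adjacent F1 F2 : bool :=
  (#|F1 :\: F2| == 1%N) && (#|F2 :\: F1| == 1%N).

Definition strongly_flag_connected : Prop :=
  forall F1 F2, is_flag F1 -> is_flag F2 ->
  exists s : seq {set T},
    [/\ path flags_adjacent F1 s, last F1 s = F2
      & forall F, F \in s -> is_flag F /\ F1 :&: F2 \subset F].

Definition diamond_condition (rank : T -> int) : Prop :=
  forall (x y : T) (j : int), (x < y)%O -> rank x = j - 1 -> rank y = j + 1 ->
  #|[set z : T | (x < z < y)%O && (rank z == j)]| = 2%N.

Definition is_abstract_polytope (rank : T -> int) (n : nat) : Prop :=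
  [/\ {homo rank : x y / (x < y)%O >-> x < y},
      forall k : int, (exists x, rank x = k) <-> - 1 <= k <= n%:Z,
      (exists x0, forall x, (x0 <= x)%O) /\ (exists x1, forall x, (x <= x1)%O),
      forall F, is_flag F -> #|F| = n.+2
    & strongly_flag_connected /\ diamond_condition rank].

Definition upper_section v : Type := {x : T | (v <= x)%O}.

HB.instance Definition _ v := SubFinite.on (upper_section v).
HB.instance Definition _ v := [SubChoice_isSubPOrder of upper_section v by <: with d].

End AbstractPolytopes.

(* The faces of the simplex of dimension m - 1 (including the empty face)
   correspond to the subsets of its m vertices, ordered by inclusion. *)
Definition simplex_face_lattice (m : nat) : Type := {set 'I_m}.

HB.instance Definition _ (m : nat) := Finite.on (simplex_face_lattice m).

Fact simplex_display : Order.disp_t. Proof. exact: Order.Disp tt tt. Qed.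

Definition simplex_face_le (m : nat) : rel (simplex_face_lattice m) :=
  fun A B => A \subset B.

Lemma simplex_face_le_refl m : reflexive (@simplex_face_le m).
Proof. by move=> A; apply: subxx. Qed.

Lemma simplex_face_le_anti m : antisymmetric (@simplex_face_le m).
Proof. by move=> A B AB; apply/eqP; rewrite eqEsubset. Qed.

Lemma simplex_face_le_trans m : transitive (@simplex_face_le m).
Proof. by move=> B A C; apply: subset_trans. Qed.

HB.instance Definition _ (m : nat) :=
  Order.Le_isPOrder.Build simplex_display (simplex_face_lattice m)
    (@simplex_face_le_refl m) (@simplex_face_le_anti m)
    (@simplex_face_le_trans m).

Definition is_simple_polytope d (T : finPOrderType d) (rank : T -> int)
    (n : nat) : Prop :=
  is_abstract_polytope rank n /\
  forall v : T, rank v = 0 ->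
    exists f : upper_section v -> simplex_face_lattice n, order_iso f.

(* A simple graph on the vertex set 'I_p is a symmetric irreflexive relation. *)
Definition edge_set (p : nat) (e : rel 'I_p) : {set {set 'I_p}} :=
  [set [set ij.1; ij.2] | ij : 'I_p * 'I_p & e ij.1 ij.2].

Definition transposition_group (p : nat) (K : {set {set 'I_p}}) : {set 'S_p} :=
  <<[set tperm ij.1 ij.2 | ij : 'I_p * 'I_p & [set ij.1; ij.2] \in K]>>%g.

Section Graphicahedron.

Context {p : nat}.
Implicit Type e : rel 'I_p.

Definition face_pair e : Type :=
  ({K : {set {set 'I_p}} | K \subset edge_set e} * 'S_p)%type.

HB.instance Definition _ e := Finite.on (face_pair e).

Definition pair_edges e (x : face_pair e) : {set {set 'I_p}} := val x.1.

Definition pair_coset e (x : face_pair e) : {set 'S_p} :=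
  (transposition_group (pair_edges x) :* x.2)%g.

Definition pair_equiv e : rel (face_pair e) :=
  fun x y => (pair_edges x == pair_edges y) && (pair_coset x == pair_coset y).

Lemma pair_equiv_refl e : reflexive (@pair_equiv e).
Proof. by move=> x; rewrite /pair_equiv !eqxx. Qed.

Lemma pair_equiv_sym e : symmetric (@pair_equiv e).
Proof. by move=> x y; congr (_ && _); apply: eq_sym. Qed.

Lemma pair_equiv_trans e : transitive (@pair_equiv e).
Proof.
by move=> y x z /andP[/eqP xy1 /eqP xy2]; rewrite /pair_equiv xy1 xy2.
Qed.

Canonical pair_equiv_rel e := EquivRel (@pair_equiv e)
  (@pair_equiv_refl e) (@pair_equiv_sym e) (@pair_equiv_trans e).

Definition face e := {eq_quot (pair_equiv_rel e)}%qT.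

HB.instance Definition _ e := Countable.on (face e).
HB.instance Definition _ e := Quotient.on (face e).
HB.instance Definition _ e : isFinite (face e) :=
  CanIsFinite (@reprK _ (face e)).

Definition pair_le e : rel (face_pair e) := fun x y =>
  (pair_edges x \subset pair_edges y) && (pair_coset x \subset pair_coset y).

Definition face_le e : rel (face e) := fun x y => pair_le (repr x) (repr y).

Definition pair_act e (x : face_pair e) (g : 'S_p) : face_pair e :=
  (x.1, x.2 * g)%g.

Definition face_act e (x : face e) (g : 'S_p) : face e :=
  (\pi_(face e) (pair_act (repr x) g))%qT.

Lemma pair_equiv_repr e (x : face_pair e) :
  pair_equiv (repr (\pi_(face e) x)%qT) x.
Proof. by apply/eqmodP; rewrite reprK. Qed.

Lemma face_leE e (x y : face_pair e) :
  face_le (\pi_(face e) x)%qT (\pi_(face e) y)%qT = pair_le x y.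
Proof.
have /andP[/eqP Kx /eqP Cx] := pair_equiv_repr x.
have /andP[/eqP Ky /eqP Cy] := pair_equiv_repr y.
by rewrite /face_le /pair_le Kx Cx Ky Cy.
Qed.

Lemma face_actE e (x : face_pair e) (g : 'S_p) :
  face_act (\pi_(face e) x)%qT g = (\pi_(face e) (pair_act x g))%qT.
Proof.
have /andP[eqK /eqP eqC] := pair_equiv_repr x.
apply/eqmodP/andP; split; first exact: eqK.
by apply/eqP; rewrite /pair_coset /= !rcosetM; congr (_ :* _)%g.
Qed.

Lemma face_le_refl e : reflexive (@face_le e).
Proof. by move=> x; rewrite /face_le /pair_le !subxx. Qed.

Lemma face_le_anti e : antisymmetric (@face_le e).
Proof.
move=> x y; rewrite /face_le /pair_le.
move=> /andP[/andP[Kxy Cxy] /andP[Kyx Cyx]].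
rewrite -[x]reprK -[y]reprK; apply/eqmodP.
by rewrite /= /pair_equiv !eqEsubset Kxy Kyx Cxy Cyx.
Qed.

Lemma face_le_trans e : transitive (@face_le e).
Proof.
move=> y x z /andP[Kxy Cxy] /andP[Kyz Cyz].
by rewrite /face_le /pair_le (subset_trans Kxy) ?(subset_trans Cxy).
Qed.

(* None is the adjoined least face. *)
Definition graphicahedron e : Type := option (face e).

HB.instance Definition _ e := Finite.on (graphicahedron e).

Fact graphicahedron_display : Order.disp_t.
Proof. exact: Order.Disp tt tt. Qed.

Definition graphicahedron_le e : rel (graphicahedron e) := fun x y =>
  match x, y with
  | None, _ => true
  | Some _, None => false
  | Some x', Some y' => face_le x' y'
  end.

Lemma graphicahedron_le_refl e : reflexive (@graphicahedron_le e).
Proof. by move=> [x|] //=; apply: face_le_refl. Qed.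

Lemma graphicahedron_le_anti e : antisymmetric (@graphicahedron_le e).
Proof. by move=> [x|] [y|] //= /face_le_anti ->. Qed.

Lemma graphicahedron_le_trans e : transitive (@graphicahedron_le e).
Proof. by move=> [y|] [x|] [z|] //=; apply: face_le_trans. Qed.

HB.instance Definition _ e := Order.Le_isPOrder.Build graphicahedron_display
  (graphicahedron e) (@graphicahedron_le_refl e) (@graphicahedron_le_anti e)
  (@graphicahedron_le_trans e).

Definition graphicahedron_rank e (x : graphicahedron e) : int :=
  if x is Some x' then #|pair_edges (repr x')|%:Z else - 1.

(* MathComp composes permutations from left to right: (a * b) i = b (a i). *)
Definition graphicahedron_act e (x : graphicahedron e) (g : 'S_p) :
    graphicahedron e :=
  if x is Some x' then Some (face_act x' g) else None.

Definition graphicahedron_vertices e : {set graphicahedron e} :=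
  [set x | graphicahedron_rank x == 0].

Definition graphicahedron_flags e : {set {set graphicahedron e}} :=
  [set F | is_flag F].

End Graphicahedron.

Definition simply_transitive (gT : finGroupType) (T : finType)
    (act : T -> gT -> T) (S : {set T}) : Prop :=
  (forall x g, x \in S -> act x g \in S) /\
  (forall x y, x \in S -> y \in S -> exists! g, act x g = y).

(* Main.v *)
(* All faces above a vertex (0, a) are of the form (K, a), so a flag is a vertex
   together with an ordering s of E(G), whose faces are the (K, a) with K a
   prefix of s; orderings are changed by adjacent swaps, vertices by generators
   tau_e of T_K, where K is the lowest edge set common to the two flags.
   Conversely, sorting the edges by the number of edge sets of a given chain
   that miss them exhibits the chain as part of such a flag. *)
Require Import Defs.
From mathcomp Require Import all_boot all_order all_algebra all_fingroup.
From mathcomp Require Import cyclic generic_quotient zify.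

(** * Groups generated by the transpositions of a set of edges *)

Section TranspositionGroup.

Set Implicit Arguments.
Unset Strict Implicit.
Unset Printing Implicit Defensive.
Import GroupScope.

Context {p : nat}.
Implicit Types (K L : {set {set 'I_p}}).

Canonical transposition_group_group K := [group of transposition_group K].

Lemma tperm_in_transposition_group K (i j : 'I_p) :
  [set i; j] \in K -> tperm i j \in transposition_group K.
Proof.
by move=> Kij; apply/mem_gen/imsetP; exists (i, j); rewrite ?inE.
Qed.

Lemma transposition_groupS K L :
  K \subset L -> transposition_group K \subset transposition_group L.
Proof.
move=> sKL; rewrite gen_subG; apply/subsetP => _ /imsetP[[i j] /= Kij ->].
by apply: tperm_in_transposition_group; apply: (subsetP sKL); rewrite inE in Kij.
Qed.

Lemma transposition_group0 : @transposition_group p set0 = 1.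
Proof.
apply/trivgP; rewrite gen_subG; apply/subsetP => g /imsetP[[i j] /=].
by rewrite !inE.
Qed.

(** An unordered pair determines its transposition, so there is one generator, an involution, and
    the group is cyclic of order two. This counts the vertices below a face of rank one. *)
Lemma transposition_group1 (i j : 'I_p) :
  i != j -> transposition_group [set [set i; j]] = [set 1; tperm i j].
Proof.
move=> ij; have nt : tperm i j != 1.
  by apply: contraNneq ij => t1; rewrite -{1}(tpermR i j) t1 perm1.
rewrite -cycle2g; last by apply: nt_prime_order => //; rewrite expgS expg1 tperm2.
congr <<_>>; apply/setP => g; rewrite inE; apply/imsetP/eqP => [[[k l]]|->].
  rewrite !inE /= => /eqP kl ->.
  have := set21 k l; have := set22 k l; rewrite kl !inE.
  move: kl => /setP kl; have := kl i; have := kl j; rewrite !inE !eqxx orbT /=.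
  move=> klj kli /pred2P[El|El] /pred2P[Ek|Ek]; move: kli klj; rewrite El Ek.
  - by rewrite !orbb (eq_sym j) (negPf ij).
  - by rewrite tpermC.
  - by [].
  - by rewrite !orbb (negPf ij).
by exists (i, j); rewrite ?inE.
Qed.

(** Every transposition is reached by induction along a path: conjugating [tperm i l] by [tperm l k]
    yields [tperm i k] when [i] differs from both [l] and [k]. Transpositions generate the symmetric
    group. *)
Lemma transposition_group_connected (e : rel 'I_p) :
  (forall i j, connect e i j) -> transposition_group (edge_set e) = [set: 'S_p].
Proof.
move=> e_conn; apply/setP => g; rewrite inE.
have Ttperm i j : tperm i j \in transposition_group (edge_set e).
  have /connectP[s + ->] := e_conn i j.
  elim/last_ind: s => [|s k IHs] /=; first by rewrite tperm1 group1.
  rewrite rcons_path last_rcons => /andP[/IHs {IHs} Ts ek].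
  have [->|neik] := eqVneq i k; first by rewrite tperm1 group1.
  have Tk : tperm (last i s) k \in transposition_group (edge_set e).
    apply/tperm_in_transposition_group/imsetP.
    by exists (last i s, k); rewrite ?inE.
  have [eil|neil] := eqVneq i (last i s); first by rewrite {1}eil.
  have := groupJ Ts Tk; rewrite tpermJ tpermL tpermD 1?eq_sym // eq_sym.
have [ts -> _] := prod_tpermP g.
by apply: group_prod => t _; apply: Ttperm.
Qed.

End TranspositionGroup.

(** * Sets of initial entries of an ordering *)

Section Prefixes.

Set Implicit Arguments.
Unset Strict Implicit.
Unset Printing Implicit Defensive.

Context {X : finType}.
Implicit Types (s t : seq X) (A K : {set X}).

Definition prefix_set s k : {set X} := [set x in take k s].

Lemma prefix_set_cat s t k : size s <= k ->
  prefix_set (s ++ t) k = [set x in s] :|: prefix_set t (k - size s).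
Proof. by move=> le_sk; apply/setP=> x; rewrite !inE take_cat ltnNge le_sk mem_cat. Qed.

(** Only the prefix that ends between the two swapped entries sees their order. *)
Lemma prefix_set_swap s t x y k : k != (size s).+1 ->
  prefix_set (s ++ x :: y :: t) k = prefix_set (s ++ y :: x :: t) k.
Proof.
move=> nek; have [lt_ks|le_sk] := ltnP k (size s).
  by apply/setP=> z; rewrite !inE !takel_cat // ltnW.
rewrite !prefix_set_cat //; congr (_ :|: _).
case Dm: (k - size s) => [|[|m]]; apply/setP=> z; rewrite !inE ?take0 //=.
  by move: nek; rewrite -(subnK le_sk) Dm eqxx.
by rewrite orbCA.
Qed.

Lemma prefix_set_leq s j k : j <= k -> prefix_set s j \subset prefix_set s k.
Proof.
move=> jk; apply/subsetP=> x; rewrite !inE -(subnKC jk) takeD mem_cat => -> //.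
Qed.

(** The entry at position [k] is the only element of the prefix set of length [k.+1] that is missing
    from the one of length [k]. *)
Lemma prefix_set_inj s t : uniq s -> uniq t -> size s = size t ->
  (forall k, k <= size s -> prefix_set s k = prefix_set t k) -> s = t.
Proof.
move=> Us Ut eq_sz eq_st; case: s => [|x0 s0] in Us eq_sz eq_st *.
  by case: t eq_sz {Ut eq_st}.
set s := x0 :: s0 in Us eq_sz eq_st *.
clearbody s.
apply: (@eq_from_nth _ x0) => // k lt_ks.
have /setP/(_ (nth x0 s k)) := eq_st k (ltnW lt_ks).
have /setP/(_ (nth x0 s k)) := eq_st k.+1 lt_ks.
have lt_kt : k < size t by rewrite -eq_sz.
rewrite !inE (take_nth x0 lt_ks) (take_nth x0 lt_kt) !mem_rcons !inE.
rewrite eqxx in_take_leq ?(ltnW lt_ks) // index_uniq // ltnn => /esym/orP[/eqP //|].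
by move=> ->.
Qed.

Variable A : {set X}.

Lemma prefix_set_sub s k : perm_eq s (enum A) -> prefix_set s k \subset A.
Proof.
move=> /perm_mem sA; apply/subsetP=> x; rewrite inE => /mem_take.
by rewrite sA mem_enum.
Qed.

Lemma card_prefix_set s k :
  perm_eq s (enum A) -> k <= #|A| -> #|prefix_set s k| = k.
Proof.
move=> sA kA; rewrite cardsE (card_uniqP _) ?take_uniq ?(perm_uniq sA) ?enum_uniq //.
by rewrite size_takel // (perm_size sA) -cardE.
Qed.

Lemma prefix_set_full s : perm_eq s (enum A) -> prefix_set s #|A| = A.
Proof.
by move=> sA; apply/eqP; rewrite eqEcard prefix_set_sub // card_prefix_set /=.
Qed.

(* Sort A by the number of members of the chain that an element misses. *)
Lemma nested_prefix_sets (Ks : {set {set X}}) :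
  (forall K, K \in Ks -> K \subset A) ->
  (forall K L, K \in Ks -> L \in Ks -> (K \subset L) || (L \subset K)) ->
  exists2 s, perm_eq s (enum A) & forall K, K \in Ks -> prefix_set s #|K| = K.
Proof.
move=> sKA nested; pose f x := #|[set K in Ks | x \notin K]|.
pose r := relpre f leq; have r_trans : transitive r by move=> y x z; apply: leq_trans.
have r_refl : reflexive r by move=> x; apply: leqnn.
pose s := sort r (enum A); have sA : perm_eq s (enum A) by rewrite perm_sort.
have s_sorted : sorted r s by apply: sort_sorted => x y; apply: leq_total.
exists s => // K KKs; have leKA := subset_leq_card (sKA K KKs).
(* Equal cardinalities leave one inclusion. If [b] is outside [K], then all of [K] precedes [b], so
   the index of [b] is at least [#|K|]. *)
apply/eqP; rewrite eqEcard card_prefix_set // leqnn andbT.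
apply/subsetP=> b; rewrite inE; apply: contraLR => bK.
rewrite in_take_leq ?(perm_size sA) -?cardE // -leqNgt.
have sK : K \subset prefix_set s (index b s).
  apply/subsetP=> a aK; have as_ : a \in s.
    by rewrite (perm_mem sA) mem_enum (subsetP (sKA K KKs)).
  rewrite inE in_take_leq ?index_size // ltnNge.
  apply/negP=> le_ba; have bs : b \in s.
    by rewrite -index_mem (leq_ltn_trans le_ba) // index_mem.
  (* This contradicts nestedness: a member missing [a] cannot contain [K], so it lies inside [K] and
     misses [b] too, while [K] itself misses [b] but not [a]. *)
  have: f b <= f a by apply: (sorted_leq_index r_trans r_refl s_sorted).
  apply/negP; rewrite -ltnNge; apply/proper_card/properP; split.
    apply/subsetP=> L; rewrite !inE => /andP[LKs aL]; rewrite LKs /=.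
    have /orP[/subsetP sKL|/subsetP sLK] := nested K L KKs LKs.
      by rewrite sKL in aL.
    by apply: contra bK; apply: sLK.
  by exists K; rewrite !inE KKs ?aK.
apply: leq_trans (subset_leq_card sK) _; rewrite cardsE.
by apply: leq_trans (card_size _) _; rewrite size_take_min geq_minl.
Qed.

End Prefixes.

(** * Faces given by representatives, with their order and rank *)

Section Faces.

Set Implicit Arguments.
Unset Strict Implicit.
Unset Printing Implicit Defensive.
Import Order.TTheory GRing.Theory Num.Theory.
Local Open Scope ring_scope.

Context {p : nat} (e : rel 'I_p).
Notation E := (edge_set e).
Implicit Types (K L : {set {set 'I_p}}) (a b g : 'S_p) (x y : graphicahedron e).
Implicit Types C : {set graphicahedron e}.

Definition no_edges : {K : {set {set 'I_p}} | K \subset E} :=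
  exist _ set0 (sub0set E).

(** [insubd] makes the constructor total: a set not contained in [E] is replaced by the empty one,
    hence the side conditions [K \subset E] below. *)
Definition mk_face K a : graphicahedron e :=
  Some (\pi_(face e) (insubd no_edges K, a))%qT.

Lemma pair_edges_insubd K a :
  K \subset E -> pair_edges (insubd no_edges K, a) = K.
Proof. exact: insubdK. Qed.

Lemma mk_face_surj x : x = None \/ exists K a, K \subset E /\ x = mk_face K a.
Proof.
case: x => [x|]; [right|by left].
case xE: (repr x) => [[K sK] a]; exists K, a; split=> //.
rewrite /mk_face -[x]reprK xE; congr (Some (\pi_(face e) _)%qT).
by congr pair; apply: val_inj; rewrite insubdK.
Qed.

(** Once [K \subset L], the group of [K] lies in that of [L], so the inclusion of cosets only
    depends on whether the representative [a] lies in the coset of [b]. *)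
Lemma mk_face_le K L a b : K \subset E -> L \subset E ->
  (mk_face K a <= mk_face L b)%O
  = (K \subset L) && (a * b^-1 \in transposition_group L)%g.
Proof.
move=> sK sL; rewrite [LHS]face_leE /pair_le /pair_coset !pair_edges_insubd //=.
apply: andb_id2l => sKL; rewrite -mem_rcoset.
apply/idP/idP => [/subsetP -> //|/rcoset_eqP <-]; first exact: rcoset_refl.
by rewrite mulSg ?transposition_groupS.
Qed.

Lemma mk_face_eq K L a b : K \subset E -> L \subset E ->
  (mk_face K a == mk_face L b)
  = (K == L) && (a * b^-1 \in transposition_group L)%g.
Proof.
move=> sK sL; rewrite eq_le !mk_face_le // eqEsubset.
have [sKL|] //= := boolP (K \subset L).
have [sLK|] /= := boolP (L \subset K); last by rewrite andbF.
have -> : K = L by apply/eqP; rewrite eqEsubset sKL.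
by apply: andb_idr => /groupVr; rewrite invMg invgK.
Qed.

Lemma rank_mk_face K a :
  K \subset E -> graphicahedron_rank (mk_face K a) = #|K|%:Z.
Proof.
move=> sK; rewrite /graphicahedron_rank /=.
have /andP[/eqP-> _] := pair_equiv_repr (insubd no_edges K, a).
by rewrite pair_edges_insubd.
Qed.

Lemma act_mk_face K a g :
  graphicahedron_act (mk_face K a) g = mk_face K (a * g)%g.
Proof. by congr Some; apply: face_actE. Qed.

(** For equal edge sets, order and equality are the same coset condition, so a strict inequality
    needs a strictly larger edge set. *)
Lemma graphicahedron_rank_lt x y :
  (x < y)%O -> graphicahedron_rank x < graphicahedron_rank y.
Proof.
have [->|[K [a [sK ->]]]] := mk_face_surj x;
  have [->|[L [b [sL ->]]]] := mk_face_surj y; rewrite ?ltxx //.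
rewrite lt_neqAle mk_face_eq // mk_face_le // !rank_mk_face //.
case: (eqVneq K L) => [->|neKL /andP[_ /andP[sKL _]]].
  by rewrite subxx /= andNb.
by rewrite ltz_nat proper_card // properEneq neKL.
Qed.


(** * Flags as a vertex with an ordering of the edges, and their number *)

Definition flag_of a (s : seq {set 'I_p}) : {set graphicahedron e} :=
  None |: [set mk_face (prefix_set s k) a | k : 'I_#|E|.+1].

Lemma flag_ofP a s x :
  reflect (x = None \/ exists2 k, k <= #|E| & x = mk_face (prefix_set s k) a)%N
          (x \in flag_of a s).
Proof.
rewrite in_setU1; apply: (iffP predU1P) => -[->|]; try by left.
  by move=> /imsetP[k _ ->]; right; exists k; rewrite // -ltnS.
by case=> k lek ->; right; apply/imsetP; exists (inord k); rewrite ?inordK.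
Qed.

Lemma mk_face_in_flag_of a s k :
  (k <= #|E|)%N -> mk_face (prefix_set s k) a \in flag_of a s.
Proof. by move=> lek; apply/flag_ofP; right; exists k. Qed.

(** The cardinality of [K] singles out the only prefix that can match, which turns membership into a
    test without an existential. *)
Lemma mem_flag_of a b s K : perm_eq s (enum E) -> K \subset E ->
  (mk_face K b \in flag_of a s)
  = (prefix_set s #|K| == K) && (a * b^-1 \in transposition_group K)%g.
Proof.
move=> sE sK; have leK := subset_leq_card sK; apply/idP/idP.
  case/flag_ofP=> // -[k lek /esym/eqP].
  rewrite mk_face_eq ?(prefix_set_sub _ sE) // => /andP[/eqP <- ->].
  by rewrite (card_prefix_set sE) // eqxx.
move=> /andP[/eqP pK abK]; apply/flag_ofP; right; exists #|K| => //.
by apply/esym/eqP; rewrite pK mk_face_eq // eqxx.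
Qed.

Lemma card_flag_of a s : perm_eq s (enum E) -> #|flag_of a s| = #|E|.+2.
Proof.
move=> sE; rewrite cardsU1 (card_imset (aT := 'I_#|E|.+1)) => [|k l].
  by rewrite card_ord; case: imsetP => // -[].
move/eqP; rewrite mk_face_eq ?(prefix_set_sub _ sE) // => /andP[/eqP eq_kl _].
apply: val_inj => /=; have := card_prefix_set sE (leq_ord k).
by rewrite eq_kl (card_prefix_set sE (leq_ord l)).
Qed.

Lemma flag_of_chain a s : perm_eq s (enum E) -> is_chain (flag_of a s).
Proof.
move=> sE; apply/forall_inP=> x /flag_ofP[->|[k lek ->]].
  exact/forall_inP.
apply/forall_inP=> y /flag_ofP[->|[l lel ->]] //.
rewrite /Order.comparable !mk_face_le ?(prefix_set_sub _ sE) // mulgV !group1 !andbT.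
by case/orP: (leq_total k l) => /prefix_set_leq ->; rewrite ?orbT.
Qed.

(** The chain already has a face of every rank, and two comparable faces of the same rank coincide,
    so nothing can be added. *)
Lemma flag_of_is_flag a s : perm_eq s (enum E) -> is_flag (flag_of a s).
Proof.
move=> sE; apply/maxsetP; split=> [|F F_chain sF]; first exact: flag_of_chain.
apply/eqP; rewrite eqEsubset sF andbT; apply/subsetP=> y Fy.
have [y0|[K [b [sK yK]]]] := mk_face_surj y; first by apply/flag_ofP; left.
have leK := subset_leq_card sK; pose z := mk_face (prefix_set s #|K|) a.
have zs : z \in flag_of a s by apply: mk_face_in_flag_of.
have rk_yz : graphicahedron_rank y = graphicahedron_rank z.
  by rewrite yK !rank_mk_face ?(prefix_set_sub _ sE) // (card_prefix_set sE).
have := forall_inP (forall_inP F_chain y Fy) z (subsetP sF z zs).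
rewrite /Order.comparable; have [<- //|ne_yz] := eqVneq z y.
case/orP=> le_yz.
  have /graphicahedron_rank_lt : (y < z)%O by rewrite lt_neqAle eq_sym ne_yz.
  by rewrite rk_yz ltxx.
have /graphicahedron_rank_lt : (z < y)%O by rewrite lt_neqAle ne_yz.
by rewrite rk_yz ltxx.
Qed.

Lemma chain_sub_flag_of (F : {set graphicahedron e}) :
  is_chain F -> exists a s, perm_eq s (enum E) /\ F \subset flag_of a s.
Proof.
move=> F_chain.
pose Ks := [set K : {set {set 'I_p}} | (K \subset E) && [exists a, mk_face K a \in F]].
have [||s sE sKs] := @nested_prefix_sets _ E Ks.
- by move=> K; rewrite inE => /andP[].
- move=> K L; rewrite !inE => /andP[sK /existsP[a Fa]] /andP[sL /existsP[b Fb]].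
  have := forall_inP (forall_inP F_chain _ Fa) _ Fb.
  by rewrite /Order.comparable !mk_face_le //; case/orP=> /andP[-> _]; rewrite ?orbT.
(* The vertex comes from a face of the chain with the fewest edges, whose coset lies in all the
   others. If the chain has no face besides possibly the least one, any permutation serves. *)
have [a aP] : exists a, forall K b, K \subset E -> mk_face K b \in F ->
    (a * b^-1 \in transposition_group K)%g.
  case: (pickP [pred Kb : {set {set 'I_p}} * 'S_p |
                  (Kb.1 \subset E) && (mk_face Kb.1 Kb.2 \in F)]) => [Kb0 P0|noF].
    case: (arg_minnP (fun Kb : {set {set 'I_p}} * 'S_p => #|Kb.1|) P0).
    case=> L a /= /andP[sL Fa] Lmin; exists a => K b sK Fb.
    have := forall_inP (forall_inP F_chain _ Fa) _ Fb.
    rewrite /Order.comparable !mk_face_le // => /orP[/andP[_ //]|/andP[sKL]].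
    (* If the comparison goes the other way, minimality forces the two edge sets to be equal, and
       membership is symmetric under inversion. *)
    have leLK: (#|L| <= #|K|)%N by apply: (Lmin (K, b)); rewrite /= sK.
    have -> : K = L by apply/eqP; rewrite eqEcard sKL.
    by move/groupVr; rewrite invMg invgK.
  by exists 1%g => K b sK Fb; have := noF (K, b); rewrite /= sK Fb.
exists a, s; split=> //; apply/subsetP=> x Fx.
have [->|[K [b [sK xK]]]] := mk_face_surj x; first by apply/flag_ofP; left.
rewrite xK in Fx *; rewrite mem_flag_of // aP // sKs ?eqxx // inE sK.
by apply/existsP; exists b.
Qed.

Lemma is_flagP F :
  reflect (exists a s, perm_eq s (enum E) /\ F = flag_of a s) (is_flag F).
Proof.
apply: (iffP idP) => [/maxsetP[F_chain Fmax]|[a [s [sE ->]]]]; last first.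
  exact: flag_of_is_flag.
have [a [s [sE sF]]] := chain_sub_flag_of F_chain.
by exists a, s; split=> //; rewrite (Fmax (flag_of a s)) // flag_of_chain.
Qed.

(** The face of rank 0 gives back the permutation, because the group of the empty set is trivial;
    the edge sets of all the faces give back the ordering. *)
Lemma flag_of_inj a b s t : perm_eq s (enum E) -> perm_eq t (enum E) ->
  flag_of a s = flag_of b t -> a = b /\ s = t.
Proof.
move=> sE tE eqF.
have st k : (k <= #|E|)%N -> prefix_set t k = prefix_set s k
    /\ (b * a^-1 \in transposition_group (prefix_set s k))%g.
  move=> lek; have := mk_face_in_flag_of a s lek.
  by rewrite eqF mem_flag_of ?(prefix_set_sub _ sE) // (card_prefix_set sE) // => /andP[/eqP].
split.
  have [_] := st 0%N isT; have -> : prefix_set s 0 = set0.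
    by apply/setP=> x; rewrite !inE take0.
  by rewrite transposition_group0 => /set1gP /(canRL (mulgKV _)); rewrite mul1g.
apply: prefix_set_inj; rewrite ?(perm_uniq sE) ?(perm_uniq tE) ?enum_uniq //.
  by rewrite (perm_size sE) (perm_size tE).
by rewrite (perm_size sE) -cardE => k /st[].
Qed.

(** Puts the orderings of [E] into the form that [card_uniq_tuples] counts. *)
Lemma perm_eq_enum_tuple (t : #|E|.-tuple {set 'I_p}) :
  perm_eq t (enum E) = all [in E] t && uniq t.
Proof.
apply/idP/andP => [tE|[/allP tE Ut]].
  rewrite (perm_uniq tE) enum_uniq; split=> //.
  by apply/allP=> x; rewrite (perm_mem tE) mem_enum.
apply: uniq_perm; rewrite ?enum_uniq //.
have [] // := @uniq_min_size _ t (enum E) Ut.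
  by move=> x /tE; rewrite mem_enum.
by rewrite !size_tuple.
Qed.

Lemma card_graphicahedron_flags :
  #|graphicahedron_flags e| = (p`! * #|E|`!)%N.
Proof.
pose D := setX [set: 'S_p] [set t : #|E|.-tuple {set 'I_p} | all [in E] t & uniq t].
have -> : graphicahedron_flags e = [set flag_of u.1 (val u.2) | u in D].
  apply/setP=> F; rewrite inE; apply/is_flagP/imsetP => [[a [s [sE ->]]]|].
    have sz : size s == #|E| by rewrite (perm_size sE) cardE.
    by exists (a, Tuple sz); rewrite // !inE /= -(perm_eq_enum_tuple (Tuple sz)).
  case=> -[a t]; rewrite !inE -perm_eq_enum_tuple /= => tE ->.
  by exists a, t.
rewrite card_in_imset => [|[a s] [b t]].
  by rewrite cardsX cardsT card_Sn card_uniq_tuples ffactnn.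
rewrite !inE /= -!perm_eq_enum_tuple => sE tE /(flag_of_inj sE tE)[-> /val_inj ->] //.
Qed.

(** * Strong flag-connectedness *)

Definition reachable (C : {set graphicahedron e}) :=
  connect [rel F1 F2 | [&& flags_adjacent F1 F2, is_flag F2 & C \subset F2]].

Lemma reachable_trans C : transitive (reachable C).
Proof. exact: connect_trans. Qed.

(** The flags agree outside level [k], so each has at most one face that the other lacks. If they
    are distinct, each has exactly one, since their cardinalities are equal. *)
Lemma reachable_one_face C a b s t k :
    perm_eq s (enum E) -> perm_eq t (enum E) -> C \subset flag_of b t ->
    (forall j, (j <= #|E|)%N -> j != k ->
       mk_face (prefix_set s j) a = mk_face (prefix_set t j) b) ->
  reachable C (flag_of a s) (flag_of b t).
Proof.
move=> sE tE sCt eq_st.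
have [->|neq_st] := eqVneq (flag_of a s) (flag_of b t); first exact: connect0.
have adj a' b' s' t' : perm_eq s' (enum E) -> perm_eq t' (enum E) ->
    (forall j, (j <= #|E|)%N -> j != k ->
       mk_face (prefix_set s' j) a' = mk_face (prefix_set t' j) b') ->
    flag_of a' s' != flag_of b' t' -> #|flag_of a' s' :\: flag_of b' t'| == 1%N.
  move=> sE' tE' eq_st' ne; rewrite eqn_leq; apply/andP; split.
    rewrite -(cards1 (mk_face (prefix_set s' k) a')) subset_leq_card //.
    apply/subsetP=> x; rewrite in_set1 in_setD andbC => /andP[/flag_ofP[->|[j lej ->]]].
      by case/negP; apply/flag_ofP; left.
    have [-> //|nejk] := eqVneq j k.
    by rewrite eq_st' // mk_face_in_flag_of.
  rewrite card_gt0 setD_eq0; apply: contra ne => sF.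
  by rewrite eqEcard sF (card_flag_of _ sE') (card_flag_of _ tE') /=.
apply: connect1; rewrite /= sCt flag_of_is_flag // /flags_adjacent.
rewrite !andbT !adj // 1?eq_sym // => j lej nejk.
by rewrite eq_st.
Qed.

(** The entry [x] moves left past [v] one swap at a time. A swap changes only the face whose prefix
    ends just before [x]. That face is not in [C]: otherwise it would also lie in the flag of [t],
    whose prefix of that length contains [x]. *)
Lemma reachable_move_front C a t (x : {set 'I_p}) u v z :
    perm_eq t (enum E) -> C \subset flag_of a t ->
    (forall k, (size u < k)%N -> x \in prefix_set t k) ->
    perm_eq (u ++ v ++ x :: z) (enum E) ->
    C \subset flag_of a (u ++ v ++ x :: z) ->
  reachable C (flag_of a (u ++ v ++ x :: z)) (flag_of a (u ++ x :: v ++ z))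
  /\ C \subset flag_of a (u ++ x :: v ++ z).
Proof.
move=> tE sCt xt; elim/last_ind: v z => [|v y IHv] z; first by split; first exact: connect0.
rewrite !cat_rcons !catA; set w := u ++ v => sE sCs.
have sE' : perm_eq (w ++ x :: y :: z) (enum E).
  by apply: perm_trans sE; rewrite perm_cat2l (perm_catCA [:: x] [:: y] z).
have x_w : x \notin w ++ [:: y].
  have := perm_uniq sE; rewrite enum_uniq -cat1s catA cat_uniq /=.
  by case/and3P=> _ /norP[].
have sCs' : C \subset flag_of a (w ++ x :: y :: z).
  apply/subsetP=> c cC.
  have /flag_ofP[->|[k lek Dc]] := subsetP sCs c cC; first by apply/flag_ofP; left.
  have [Dk|nek] := eqVneq k (size w).+1; last first.
    by rewrite Dc prefix_set_swap // mk_face_in_flag_of.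
  have := subsetP sCt c cC; rewrite Dc mem_flag_of ?(prefix_set_sub _ sE) //.
  rewrite (card_prefix_set sE) // => /andP[/eqP/setP/(_ x) + _].
  rewrite xt; last by rewrite Dk ltnS size_cat leq_addr.
  rewrite Dk prefix_set_cat // subSnn !inE /= => /esym x_wy.
  by rewrite mem_cat inE x_wy in x_w.
have [] := IHv (y :: z); rewrite !catA //.
move=> r1 sC; split=> //; apply: reachable_trans r1.
apply: (reachable_one_face (k := (size w).+1)) => // j _ nej.
by rewrite prefix_set_swap.
Qed.

Lemma reachable_reorder C a s t :
    perm_eq s (enum E) -> perm_eq t (enum E) ->
    C \subset flag_of a s -> C \subset flag_of a t ->
  reachable C (flag_of a s) (flag_of a t).
Proof.
move=> sE tE sCs sCt.
(* Selection sort: [u] is the part of [t] already in place, and each round brings the next entry of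
   [t] directly behind [u]. *)
suffices H t' u s' : t = u ++ t' -> perm_eq s' t' -> perm_eq (u ++ s') (enum E) ->
    C \subset flag_of a (u ++ s') -> reachable C (flag_of a (u ++ s')) (flag_of a t).
  by apply: (H t [::] s) => //; apply: perm_trans sE _; rewrite perm_sym.
elim: t' u s' {s sE sCs} => [|x t' IHt] u s Dt.
  by move/perm_nilP->; rewrite -Dt => *; apply: connect0.
move=> st sE sCs; have xs : x \in s by rewrite (perm_mem st) mem_head.
case/path.splitPr: xs => v z in st sE sCs *.
have xt k : (size u < k)%N -> x \in prefix_set t k.
  move=> ltk; rewrite Dt prefix_set_cat 1?ltnW //; move: ltk; rewrite -subn_gt0.
  by case: (k - _)%N => // m _; rewrite !inE eqxx orbT.
have [r1 sC1] := reachable_move_front tE sCt xt sE sCs.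
apply: reachable_trans r1 _; rewrite -cat_rcons.
apply: IHt; rewrite ?cat_rcons //.
  by rewrite -(perm_cons x); apply: perm_trans st; rewrite (perm_catCA [:: x] v z).
by apply: perm_trans sE; rewrite perm_cat2l (perm_catCA [:: x] v z).
Qed.

Lemma mk_face_mull K a g : K \subset E -> g \in transposition_group K ->
  mk_face K (g * a)%g = mk_face K a.
Proof. by move=> sK gK; apply/eqP; rewrite mk_face_eq // eqxx mulgK. Qed.

(* A generator of the group of the lowest common face is made the first edge,
   so that applying it changes the vertex of the flag and nothing else. *)
Lemma reachable_move_vertex C a s m g :
    perm_eq s (enum E) -> (m <= #|E|)%N ->
    (forall x, x \in C -> x = None \/
       exists2 k, (m <= k <= #|E|)%N & x = mk_face (prefix_set s k) a) ->
    g \in transposition_group (prefix_set s m) ->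
  reachable C (flag_of a s) (flag_of (g * a)%g s).
Proof.
move=> sE lem Cm.
(* Apart from the least face, [C] lives at levels [m] and above, where neither a factor [h] from the
   group at level [m] nor a reordering of the first [m] edges changes anything. *)
have sub_flag h t : h \in transposition_group (prefix_set s m) ->
    (forall k, (m <= k)%N -> prefix_set t k = prefix_set s k) ->
    C \subset flag_of (h * a)%g t.
  move=> hT eq_ts; apply/subsetP=> x /Cm[->|[k /andP[lemk lek] ->]].
    by apply/flag_ofP; left.
  rewrite -(mk_face_mull a (prefix_set_sub k sE) (g := h)).
    by rewrite -eq_ts // mk_face_in_flag_of.
  exact: subsetP (transposition_groupS (prefix_set_leq s lemk)) _ hT.
have step h i j : h \in transposition_group (prefix_set s m) ->
    [set i; j] \in prefix_set s m ->
    reachable C (flag_of (h * a)%g s) (flag_of (tperm i j * h * a)%g s).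
  set x := [set i; j] => hT xm; have xs : x \in take m s by rewrite inE in xm.
  have ijT := tperm_in_transposition_group xm.
  pose t := (x :: rem x (take m s)) ++ drop m s.
  have tE : perm_eq t (enum E).
    apply: perm_trans sE; rewrite -[in X in perm_eq _ X](cat_take_drop m s).
    by rewrite perm_cat2r perm_sym perm_to_rem.
  have sz_m : size (take m s) = m by rewrite size_takel // (perm_size sE) -cardE.
  have sz_t : size (x :: rem x (take m s)) = m.
    by rewrite -(perm_size (perm_to_rem xs)).
  have eq_ts k : (m <= k)%N -> prefix_set t k = prefix_set s k.
    move=> lemk; rewrite -[in RHS](cat_take_drop m s).
    rewrite !prefix_set_cat ?sz_m ?sz_t //; congr (_ :|: _).
    by apply/setP=> z; rewrite !in_set (perm_mem (perm_to_rem xs)).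
  apply: (@reachable_trans _ (flag_of (h * a)%g t)).
    by apply: reachable_reorder; rewrite ?sub_flag.
  apply: (@reachable_trans _ (flag_of (tperm i j * h * a)%g t)); last first.
    by apply: reachable_reorder; rewrite ?sub_flag ?groupM.
  apply: (reachable_one_face (k := 0%N)); rewrite ?sub_flag ?groupM // => k lek k0.
  rewrite -mulgA (mk_face_mull (h * a)) ?(prefix_set_sub _ tE) //.
  apply: tperm_in_transposition_group.
  by case: k k0 {lek} => // k _; rewrite !inE eqxx.
(* Factors act from the left on [a], so the first generator of the product is applied last. *)
case/gen_prodgP=> n [c cT ->]; elim: n c cT => [|n IHn] c cT.
  by rewrite big_ord0 mul1g; apply: connect0.
rewrite big_ord_recl.
have /imsetP[[i j] /= ij ->] := cT ord0; rewrite inE in ij.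
have := IHn (fun k => c (lift ord0 k)) (fun k => cT _).
move=> /reachable_trans; apply; apply: step ij.
by apply: group_prod => k _; apply: mem_gen.
Qed.

Hypothesis e_conn : forall i j, connect e i j.

(** Let [m] be the least level at which the flags share a face. The group of that face contains
    [b * a^-1], so the vertex can be moved from [a] to [b] with the order [s] kept; afterwards [s]
    is reordered into [t]. *)
Lemma graphicahedron_connected :
  @strongly_flag_connected _ (graphicahedron e).
Proof.
move=> F1 F2 /is_flagP[a [s [sE ->]]] /is_flagP[b [t [tE ->]]].
set C := _ :&: _.
have ex_m : exists m, (m <= #|E|)%N && (mk_face (prefix_set s m) a \in flag_of b t).
  (* The greatest face is always shared: connectedness makes its group all of the symmetric
     group. *)
  exists #|E|; rewrite leqnn (prefix_set_full sE) mem_flag_of //.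
  by rewrite (prefix_set_full tE) eqxx transposition_group_connected ?inE.
case: (ex_minnP ex_m) => m /andP[lem]; rewrite mem_flag_of ?(prefix_set_sub _ sE) //.
case/andP=> _ baT min_m.
have Cm x : x \in C -> x = None \/
    exists2 k, (m <= k <= #|E|)%N & x = mk_face (prefix_set s k) a.
  rewrite inE => /andP[/flag_ofP[->|[k lek ->]] xt]; [by left|right].
  by exists k; rewrite // lek min_m // lek.
have sCs : C \subset flag_of b s.
  apply/subsetP=> x /Cm[->|[k /andP[lemk lek] ->]]; first by apply/flag_ofP; left.
  rewrite -(mk_face_mull a (prefix_set_sub k sE) (g := (b * a^-1)%g)).
    by rewrite mulgKV mk_face_in_flag_of.
  exact: subsetP (transposition_groupS (prefix_set_leq s lemk)) _ baT.
have : reachable C (flag_of a s) (flag_of b t).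
  apply: (@reachable_trans _ (flag_of b s)).
    by have := reachable_move_vertex sE lem Cm baT; rewrite mulgKV.
  by apply: reachable_reorder; rewrite ?subsetIr.
(* Each step of [reachable] constrains its target, and [fs] lists exactly these targets. *)
case/connectP=> fs fs_path ->; exists fs; split=> //.
  by apply: sub_path fs_path => F G /and3P[].
elim: fs (flag_of a s) fs_path => //= F fs IHfs F0 /andP[/and3P[_ flF sCF] fs_path] G.
by rewrite inE => /predU1P[->|/(IHfs _ fs_path)].
Qed.

(** * Extreme faces, vertices, vertex-figures and the range of the rank *)

Lemma graphicahedron_least x : ((None : graphicahedron e) <= x)%O.
Proof. by []. Qed.

Lemma graphicahedron_greatest x : (x <= mk_face E 1%g)%O.
Proof.
have [->|[K [a [sK ->]]]] := mk_face_surj x; first exact: graphicahedron_least.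
by rewrite mk_face_le // sK transposition_group_connected ?inE.
Qed.

Lemma mk_face0_surj x : graphicahedron_rank x = 0 -> exists a, x = mk_face set0 a.
Proof.
have [->|[K [a [sK ->]]]] := mk_face_surj x; first by [].
by rewrite rank_mk_face // => -[/cards0_eq ->]; exists a.
Qed.

Lemma mk_face0_inj : injective (mk_face set0).
Proof.
move=> a b /eqP; rewrite mk_face_eq ?sub0set // eqxx transposition_group0 /=.
by move=> /set1gP /(canRL (mulgKV _)); rewrite mul1g.
Qed.

Lemma graphicahedron_verticesE :
  graphicahedron_vertices e = [set mk_face set0 a | a in [set: 'S_p]].
Proof.
apply/setP=> x; rewrite inE; apply/eqP/imsetP => [/mk_face0_surj[a ->]|[a _ ->]].
  by exists a.
by rewrite rank_mk_face ?sub0set // cards0.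
Qed.

Lemma card_graphicahedron_vertices : #|graphicahedron_vertices e| = p`!.
Proof.
rewrite graphicahedron_verticesE card_imset; last exact: mk_face0_inj.
by rewrite cardsT card_Sn.
Qed.

(** The representative of a larger face can be changed to [a], as both lie in the same coset. Above
    a fixed face, the order thus becomes inclusion of edge sets. *)
Lemma mk_face_leP K a x : K \subset E ->
  reflect (exists L, [/\ L \subset E, K \subset L & x = mk_face L a])
          (mk_face K a <= x)%O.
Proof.
move=> sK; apply: (iffP idP) => [|[L [sL sKL ->]]]; last first.
  by rewrite mk_face_le // sKL mulgV group1.
have [->|[L [b [sL ->]]]] //= := mk_face_surj x.
rewrite mk_face_le // => /andP[sKL abT]; exists L; split=> //.
by rewrite -{1}(mulgKV a b) mk_face_mull // -groupV invMg invgK.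
Qed.

Lemma mk_face_same_le K L a : K \subset E -> L \subset E ->
  (mk_face K a <= mk_face L a)%O = (K \subset L).
Proof. by move=> sK sL; rewrite mk_face_le // mulgV group1 andbT. Qed.

Lemma upper_section_iso (v : graphicahedron e) : graphicahedron_rank v = 0 ->
  exists f : upper_section v -> simplex_face_lattice #|E|, order_iso f.
Proof.
move=> /mk_face0_surj[a ->{v}]; set v := mk_face set0 a.
pose g (A : {set 'I_#|E|}) := [set enum_val i | i in A].
have gE A : g A \subset E by apply/subsetP=> _ /imsetP[i _ ->]; apply: enum_valP.
have v_le A : (v <= mk_face (g A) a)%O.
  by apply/mk_face_leP; rewrite ?sub0set //; exists (g A); rewrite sub0set gE.
(* The inverse map is the explicit one: a set of edge indices gives a face above [v]. The map [f] is
   then chosen from surjectivity of [G], and injectivity of [G] follows from its monotonicity. *)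
pose G (A : simplex_face_lattice #|E|) : upper_section v := exist (fun x => (v <= x)%O) _ (v_le A).
have G_mono : {mono G : A B / (A <= B)%O}.
  move=> A B; rewrite [LHS](mk_face_same_le a (gE A) (gE B)).
  apply/subsetP/subsetP => [sAB i Ai|sAB _ /imsetP[i Ai ->]].
    by have := sAB _ (imset_f _ Ai); rewrite mem_imset //; apply: enum_val_inj.
  by rewrite imset_f ?sAB.
have G_surj (x : upper_section v) : exists A, G A == x.
  case: x => x vx; have [|L [sL _ Dx]] := mk_face_leP _ _ _ vx; first exact: sub0set.
  exists [set i | enum_val i \in L]; apply/eqP/val_inj => /=; rewrite Dx.
  congr mk_face; apply/setP=> y; apply/imsetP/idP => [[i + ->]|Ly].
    by rewrite inE.
  have Ey := subsetP sL y Ly.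
  by exists (enum_rank_in Ey y); rewrite ?inE enum_rankK_in.
pose f (x : upper_section v) := xchoose (G_surj x).
have fK : cancel f G by move=> x; apply/eqP/(xchooseP (G_surj x)).
have Gf : cancel G f by move=> A; apply: (inc_inj G_mono); rewrite fK.
exists f; split; first by exists G.
by move=> x y; rewrite -G_mono !fK.
Qed.

Lemma graphicahedron_rank_onto (k : int) :
  (exists x, graphicahedron_rank x = k) <-> - 1 <= k <= #|E|%:Z.
Proof.
split=> [[x <-]|].
  have [->|[K [a [sK ->]]]] := mk_face_surj x; first by [].
  by rewrite rank_mk_face // lez_nat subset_leq_card // andbT.
(* Of the negative integers only [Negz 0], that is -1, is in range, and the least face attains
   it. *)
case: k => [k /andP[_]|[|k]] //; last by exists None.
rewrite lez_nat => lek; exists (mk_face (prefix_set (enum E) k) 1%g).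
by rewrite rank_mk_face ?prefix_set_sub // (card_prefix_set (perm_refl _) lek).
Qed.

(** * The diamond condition *)

Hypothesis e_irr : irreflexive e.

(** Above the least face, [y] has a single edge, and irreflexivity makes its transposition
    nontrivial, so its coset consists of two vertices. Above a face with edge set [K], the larger
    edge set [L] has two more edges, and a face in between adds one of them. *)
Lemma graphicahedron_diamond : diamond_condition (@graphicahedron_rank p e).
Proof.
move=> x y j; have [->|[K [a [sK ->]]]] := mk_face_surj x.
  move=> _ j0; have {j0}-> : j = 0 by move: j0 => /=; lia.
  have [->|[L [a [sL ->]]]] := mk_face_surj y; first by [].
  rewrite rank_mk_face // add0r => -[/eqP/cards1P[z DL]].
  rewrite DL sub1set in sL *; have /imsetP[[i k] + Dz] := sL.
  rewrite inE /= => eik.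
  have ne_ik : i != k by apply: contraTneq eik => ->; rewrite e_irr.
  have sz : [set z] \subset E by rewrite sub1set.
  have ne_t : 1%g != tperm i k.
    by apply: contraNneq ne_ik => t1; rewrite -{1}(tpermR i k) -t1 perm1.
  transitivity #|[set mk_face set0 (g * a)%g | g in [set 1%g; tperm i k]]|.
    apply: eq_card => w; rewrite inE; apply/idP/imsetP.
      case/andP=> /andP[_ /ltW w_le] /eqP/mk_face0_surj[b Dw].
      rewrite Dw mk_face_le ?sub0set // Dz transposition_group1 // in w_le.
      by exists (b * a^-1)%g => //; rewrite mulgKV.
    case=> g gT ->; rewrite rank_mk_face ?sub0set // cards0 eqxx andbT.
    apply/andP; split; first by rewrite lt_neqAle.
    rewrite lt_neqAle mk_face_eq ?sub0set // mk_face_le ?sub0set //.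
    rewrite Dz transposition_group1 // mulgK gT !andbT.
    by rewrite eq_sym -card_gt0 cards1.
  rewrite card_imset ?cards2 ?ne_t // => g h /mk_face0_inj.
  exact: mulIg.
case: (mk_face_surj y) => [->|]; first by rewrite lt_neqAle andbF.
case=> L0 [b0 [_ ->]] lt_xy; have /mk_face_leP[//|L [sL sKL Dy]] := ltW lt_xy.
rewrite {b0 L0}Dy in lt_xy *; rewrite !rank_mk_face // => rkK rkL.
have cLK : #|L :\: K| = 2%N by rewrite cardsDS //; lia.
transitivity #|[set mk_face (x |: K) a | x in L :\: K]|; last first.
  rewrite card_in_imset // => u v /setDP[uL uK] /setDP[vL vK] /eqP.
  rewrite mk_face_eq ?subUset ?sub1set ?(subsetP sL) // => /andP[/eqP/setP/(_ u) + _].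
  by rewrite !inE eqxx (negPf uK) !orbF => /esym/eqP.
apply: eq_card => w; rewrite inE; apply/idP/imsetP.
  case/andP=> /andP[/ltW /mk_face_leP[//|M [sM sKM Dw]]].
  rewrite {}Dw rank_mk_face // => /ltW; rewrite mk_face_same_le // => sML /eqP rkM.
  have /eqP/cards1P[u Du] : #|M :\: K| = 1%N by rewrite cardsDS //; lia.
  exists u; first by rewrite (subsetP (setSD K sML)) // Du set11.
  by rewrite -Du setUC setDE setUIr setUCr setIT (setUidPr sKM).
case=> u /setDP[uL uK] ->.
have suK : u |: K \subset E by rewrite subUset sub1set (subsetP sL) ?sK.
rewrite rank_mk_face // cardsU1 uK !lt_neqAle !mk_face_eq // !mk_face_same_le //.
rewrite subsetUr subUset sub1set uL sKL !andbT; apply/andP; split; last by apply/eqP; lia.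
rewrite mulgV !group1 !andbT; apply/andP; split.
  by apply: contraNneq uK => eqK; rewrite eqK setU11.
by apply/eqP=> eqL; move: rkL; rewrite -eqL cardsU1 uK; lia.
Qed.

(** * The action of the symmetric group *)

Lemma graphicahedron_actK g :
  cancel (fun x => @graphicahedron_act p e x g) (@graphicahedron_act p e ^~ g^-1%g).
Proof.
move=> x; have [->|[K [a [sK ->]]]] := mk_face_surj x; first by [].
by rewrite !act_mk_face mulgK.
Qed.

Lemma graphicahedron_act_is_action :
  is_action [set: 'S_p] (@graphicahedron_act p e).
Proof.
split=> [g|x g h _ _]; first exact: can_inj (graphicahedron_actK g).
have [->|[K [a [sK ->]]]] := mk_face_surj x; first by [].
by rewrite !act_mk_face mulgA.
Qed.

Lemma graphicahedron_act_iso g :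
  order_iso (fun x => @graphicahedron_act p e x g).
Proof.
split; last first.
  move=> x y.
  have [->|[K [a [sK ->]]]] := mk_face_surj x; first by [].
  have [->|[L [b [sL ->]]]] := mk_face_surj y; first by [].
  (* The order only involves the quotient [a * b^-1], in which right multiplication by [g]
     cancels. *)
  by rewrite !act_mk_face !mk_face_le // invMg mulgA mulgK.
exact/injF_bij/can_inj/graphicahedron_actK.
Qed.

(** Vertices correspond to permutations, and on them the action is right translation of the group on
    itself. *)
Lemma graphicahedron_act_simply_transitive :
  simply_transitive (@graphicahedron_act p e) (graphicahedron_vertices e).
Proof.
rewrite graphicahedron_verticesE; split=> [_ g /imsetP[a _ ->]|].
  by rewrite act_mk_face imset_f.
move=> _ _ /imsetP[a _ ->] /imsetP[b _ ->]; exists (a^-1 * b)%g; split.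
  by rewrite act_mk_face mulKVg.
by move=> g; rewrite act_mk_face => /mk_face0_inj <-; rewrite mulKg.
Qed.

End Faces.

Theorem theorem1 (p q : nat) (e : rel 'I_p)
    (e_sym : symmetric e) (e_irr : irreflexive e)
    (p_gt0 : (0 < p)%N) (e_conn : forall i j : 'I_p, connect e i j)
    (q_edges : #|edge_set e| = q) :
  [/\ is_simple_polytope (@graphicahedron_rank p e) q,
      #|graphicahedron_vertices e| = p`!,
      #|graphicahedron_flags e| = (p`! * q`!)%N
    & [/\ is_action [set: 'S_p] (@graphicahedron_act p e),
          forall g : 'S_p, order_iso (fun x => @graphicahedron_act p e x g)
        & simply_transitive (@graphicahedron_act p e)
            (graphicahedron_vertices e)]].
Proof.
rewrite -q_edges; split.
- split; last exact: upper_section_iso.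
  split.
  + exact: graphicahedron_rank_lt.
  + exact: graphicahedron_rank_onto.
  + split; first by exists None; apply: graphicahedron_least.
    by eexists; apply: graphicahedron_greatest.
  + by move=> F /is_flagP[a [s [sE ->]]]; apply: card_flag_of.
  + by split; [apply: graphicahedron_connected|apply: graphicahedron_diamond].
- exact: card_graphicahedron_vertices.
- exact: card_graphicahedron_flags.
- split.
  + exact: graphicahedron_act_is_action.
  + exact: graphicahedron_act_iso.
  + exact: graphicahedron_act_simply_transitive.
Qed.
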